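(* Suppose a finite Markov chain $(X,Q,\pi)$ with a mean $\theta\le\theta_a$ satisfies $CD_\theta(K,n)$, where $K\in\mathbb{R}$ and $n\in(0,\infty]$. Then for all $\rho\in(I_\theta)^X$, $f\in\mathbb{R}^X$ and $t\ge0$, $$\langle f^2,P_t\rho\rangle_\pi-\langle(P_tf)^2,\rho\rangle_\pi\ \ge\ \frac{e^{2Kt}-1}{K}\,\mathcal{A}_\rho(P_tf)+\frac1{Kn}\left(\frac{e^{2Kt}-1}{K}-2t\right)\langle\rho,(\Delta P_tf)^2\rangle_\pi,$$ where for $K=0$ the coefficients are understood as their limits $2t$ and $\frac{2t^2}{n}$ as $K\to0$. In particular, $CD_\theta(0,\infty)$ implies $$\langle f^2,P_t\rho\rangle_\pi\ge2t\,\mathcal{A}_\rho(P_tf).$$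
   Context: A finite Markov chain $(X,Q,\pi)$ is always assumed irreducible and reversible: $X$ is a finite set, $Q:X\times X\to[0,1]$ satisfies $\sum_{y}Q(x,y)=1$ for all $x$ and is irreducible, $\pi\in(0,1]^X$ is the unique stationary probability measure, and $Q(x,y)\pi(x)=Q(y,x)\pi(y)$ for all $x,y$. For $f,g\in\mathbb{R}^X$ put $\langle f,g\rangle_\pi=\sum_{x}f(x)g(x)\pi(x)$ and $\Delta f(x)=\sum_{y}(f(y)-f(x))Q(x,y)$. $P_t=e^{t\Delta}$, $t\ge 0$, is the heat semigroup on $\mathbb{R}^X$. A mean is a function $\theta:[0,\infty)\times[0,\infty)\to[0,\infty)$ which is continuous, smooth on $(0,\infty)\times(0,\infty)$, symmetric, monotone ($\theta(r,s)\ge\theta(t,s)$ for $r\ge t$), homogeneous ($\theta(\lambda r,\lambda s)=\lambda\theta(r,s)$) and normalized ($\theta(1,1)=1$). The arithmetic mean is $\theta_a(r,s)=\frac{r+s}2$; $\theta\le\theta_a$ is meant pointwise. Set $I_\theta=(0,\infty)$ if $\theta(0,s)=0$ for all $s>0$, and $I_\theta=[0,\infty)$ if $\theta(0,s)>0$ for all $s>0$. Write $\partial_1\theta(r,s)=\frac{\partial}{\partial r}\theta(r,s)$ (at boundary points $r=0$ or $s=0$, relevant only if $I_\theta=[0,\infty)$, this is the one-sided partial derivative, implicitly assumed to exist where it is used). For $\rho\in(I_\theta)^X$ define $\Delta_\rho f(x)=\sum_{y}2\,\partial_1\theta(\rho(x),\rho(y))(f(y)-f(x))Q(x,y)$, $2\Gamma_\rho(f,g)=\Delta_\rho(fg)-f\Delta_\rho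 g-g\Delta_\rho f$, $2\Gamma_{2,\rho}(f,g)=\Delta\Gamma_\rho(f,g)-\Gamma_\rho(f,\Delta g)-\Gamma_\rho(g,\Delta f)$, $\Gamma_\rho f=\Gamma_\rho(f,f)$, $\Gamma_{2,\rho}f=\Gamma_{2,\rho}(f,f)$, and $$\mathcal{A}_\rho(f)=\frac12\sum_{x,y\in X}\theta(\rho(x),\rho(y))(f(y)-f(x))^2Q(x,y)\pi(x).$$ $X$ satisfies $CD_\theta(K,n)$ if $\langle\rho,\Gamma_{2,\rho}f-\frac1n(\Delta f)^2-K\Gamma_\rho f\rangle_\pi\ge0$ for all $\rho\in(I_\theta)^X$ and all $f\in\mathbb{R}^X$. Convention: $\frac1n=0$ for $n=\infty$. *)

(* Defs.v *)
From HB Require Import structures.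
From mathcomp Require Import all_boot all_order all_algebra.
From mathcomp Require Import all_classical all_reals all_analysis.

Set Implicit Arguments.
Unset Strict Implicit.
Unset Printing Implicit Defensive.

Import Order.TTheory GRing.Theory Num.Theory.
Import numFieldNormedType.Exports.

Local Open Scope classical_set_scope.
Local Open Scope ring_scope.

Definition stationary_probability (R : realType) (X : finType)
    (Q : X -> X -> R) (mu : X -> R) : Prop :=
  [/\ forall x, 0 <= mu x,
      \sum_(x : X) mu x = 1
    & forall y, \sum_(x : X) mu x * Q x y = mu y].

(* Irreducibility: any two states are joined by a path of transitions of
   positive probability. *)
Record markov_chain (R : realType) (X : finType) (Q : X -> X -> R)
    (pi : X -> R) : Prop := MarkovChain {
  markov_kernel_ge0_le1 : forall x y, 0 <= Q x y <= 1;
  markov_kernel_sum : forall x, \sum_(y : X) Q x y = 1;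
  markov_irreducible : forall x y, connect (fun a b => 0 < Q a b) x y;
  markov_measure_gt0_le1 : forall x, 0 < pi x <= 1;
  markov_stationary : stationary_probability Q pi;
  markov_unique : forall mu, stationary_probability Q mu -> mu = pi;
  markov_reversible : forall x y, Q x y * pi x = Q y x * pi y
}.

Definition inner (R : realType) (X : finType) (pi f g : X -> R) : R :=
  \sum_(x : X) f x * g x * pi x.

Definition laplacian (R : realType) (X : finType) (Q : X -> X -> R)
    (f : X -> R) : X -> R :=
  fun x => \sum_(y : X) (f y - f x) * Q x y.

(* e^{t Delta} f as the (pointwise convergent) exponential series
   \sum_k t^k / k! Delta^k f. *)
Definition heat (R : realType) (X : finType) (Q : X -> X -> R) (t : R)
    (f : X -> R) : X -> R :=
  fun x => limn (series (fun k : nat =>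
    t ^+ k / (k`!)%:R * iter k (laplacian Q) f x)).

(* f is of class C^k on ]0, +oo[ x ]0, +oo[: all mixed partial derivatives of
   order at most k, taken in any order, exist and are jointly continuous
   there. *)
Fixpoint Ck_quadrant (R : realType) (k : nat) (f : R -> R -> R) : Prop :=
  (forall r s : R, 0 < r -> 0 < s ->
     {for (r, s), continuous (fun p : R * R => f p.1 p.2)}) /\
  (if k is k'.+1 then
     [/\ forall r s : R, 0 < r -> 0 < s ->
           derivable (f^~ s) r 1 /\ derivable (f r) s 1,
         Ck_quadrant k' (partial1of2 f)
       & Ck_quadrant k' (fun r s => derive1 (f r) s)]
   else True).

(* A mean is defined on [0, +oo[ x [0, +oo[ only: here theta is total, but its
   values outside this set are unconstrained and never used. *)
Record mean (R : realType) (theta : R -> R -> R) : Prop := Mean {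
  mean_ge0 : forall r s : R, 0 <= r -> 0 <= s -> 0 <= theta r s;
  mean_continuous :
    {within [set p : R * R | 0 <= p.1 /\ 0 <= p.2],
      continuous (fun p : R * R => theta p.1 p.2)};
  mean_smooth : forall k, Ck_quadrant k theta;
  mean_symmetric : forall r s : R, 0 <= r -> 0 <= s -> theta r s = theta s r;
  mean_monotone : forall r t s : R, 0 <= t -> t <= r -> 0 <= s ->
    theta t s <= theta r s;
  mean_homogeneous : forall a r s : R, 0 < a -> 0 <= r -> 0 <= s ->
    theta (a * r) (a * s) = a * theta r s;
  mean_normalized : theta 1 1 = 1
}.

Definition theta_a (R : realType) (r s : R) : R := (r + s) / 2.

(* By homogeneity, theta 0 s either vanishes for all s > 0 or is positive for
   all s > 0. *)
Definition mean_domain (R : realType) (theta : R -> R -> R) : set R :=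
  if `[< forall s : R, 0 < s -> theta 0 s = 0 >]
  then [set r | 0 < r] else [set r | 0 <= r].

Definition boundary_quotient (R : realType) (theta : R -> R -> R) (s h : R) : R :=
  (theta h s - theta 0 s) / h.

(* The partial derivative of theta in its first variable, one-sided at
   r = 0. *)
Definition partial1 (R : realType) (theta : R -> R -> R) (r s : R) : R :=
  if 0 < r then partial1of2 theta r s
  else lim (boundary_quotient theta s h @[h --> 0^'+]).

(* Existence of the partial derivatives that [partial1] evaluates on
   mean_domain theta x mean_domain theta and that are not provided by [mean].
   For r > 0 there is nothing to require: on the interior theta is smooth, and
   at s = 0 homogeneity makes theta r 0 linear in r. *)
Definition has_boundary_partial1 (R : realType) (theta : R -> R -> R) : Prop :=
  mean_domain theta 0 ->
  forall s : R, 0 <= s -> cvg (boundary_quotient theta s h @[h --> 0^'+]).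

Definition laplacian_rho (R : realType) (X : finType) (Q : X -> X -> R)
    (theta : R -> R -> R) (rho f : X -> R) : X -> R :=
  fun x => \sum_(y : X)
    2 * partial1 theta (rho x) (rho y) * (f y - f x) * Q x y.

Definition Gamma_rho (R : realType) (X : finType) (Q : X -> X -> R)
    (theta : R -> R -> R) (rho f g : X -> R) : X -> R :=
  fun x => 2^-1 * (laplacian_rho Q theta rho (fun z => f z * g z) x
                   - f x * laplacian_rho Q theta rho g x
                   - g x * laplacian_rho Q theta rho f x).

Definition Gamma2_rho (R : realType) (X : finType) (Q : X -> X -> R)
    (theta : R -> R -> R) (rho f g : X -> R) : X -> R :=
  fun x => 2^-1 * (laplacian Q (Gamma_rho Q theta rho f g) x
                   - Gamma_rho Q theta rho f (laplacian Q g) x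
                   - Gamma_rho Q theta rho g (laplacian Q f) x).

Definition action_functional (R : realType) (X : finType) (Q : X -> X -> R)
    (pi : X -> R) (theta : R -> R -> R) (rho f : X -> R) : R :=
  2^-1 * \sum_(x : X) \sum_(y : X)
    theta (rho x) (rho y) * (f y - f x) ^+ 2 * Q x y * pi x.

(* 1/n for n in ]0, +oo], equal to 0 when n = +oo. *)
Definition inv_dim (R : realType) (n : \bar R) : R := fine (n^-1)%E.

Definition CD (R : realType) (X : finType) (Q : X -> X -> R) (pi : X -> R)
    (theta : R -> R -> R) (K : R) (n : \bar R) : Prop :=
  forall rho f : X -> R, (forall x, mean_domain theta (rho x)) ->
    0 <= inner pi rho (fun x =>
           Gamma2_rho Q theta rho f f x
           - inv_dim n * laplacian Q f x ^+ 2
           - K * Gamma_rho Q theta rho f f x).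

(* (e^{2Kt} - 1) / K, extended by its limit at K = 0. *)
Definition gradient_coeff (R : realType) (K t : R) : R :=
  if K == 0 then 2 * t else (expR (2 * K * t) - 1) / K.

(* ((e^{2Kt} - 1) / K - 2t) / (Kn), extended by its limit at K = 0. *)
Definition dimension_coeff (R : realType) (K : R) (n : \bar R) (t : R) : R :=
  if K == 0 then 2 * t ^+ 2 * inv_dim n
  else K^-1 * inv_dim n * ((expR (2 * K * t) - 1) / K - 2 * t).

(* Main.v *)
Require Import Defs.
From HB Require Import structures.
From mathcomp Require Import all_boot all_order all_algebra.
From mathcomp Require Import all_classical all_reals all_analysis.
From mathcomp Require Import ring lra.

Set Implicit Arguments.
Unset Strict Implicit.
Unset Printing Implicit Defensive.

Import Order.TTheory GRing.Theory Num.Theory.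
Import numFieldNormedType.Exports.

Local Open Scope classical_set_scope.
Local Open Scope ring_scope.

(** Write P_s for the heat semigroup, fix rho and f, and interpolate between the
    two sides: for 0 <= s <= t put r = P_s rho, g = P_(t-s) f and
      G(s) = <g^2, r>,  A(s) = action of g with respect to r,
      B(s) = <(Delta g)^2, r>.
    Then G(t) - G(0) is the left-hand side of the inequality, and three
    differential inequalities hold when rho > 0:
    - G' >= 2 A, because G' = sum_(x,y) r(x) (g(y) - g(x))^2 Q(x,y) pi(x)
      ([laplacian_carre_du_champ]), which is twice the action for the
      arithmetic mean, and theta is below that mean
      ([action_le_carre_du_champ]);
    - A' >= 2 K A + (2/n) B, because A' = 2 <r, Gamma_2 g>
      ([is_derive_action]), so that this is exactly the curvature-dimension
      condition ([CD_action_growth]);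
    - B' >= 0, since B' is an integrated carre du champ of Delta g.
    The two coefficients c and d of the theorem solve c' = 2 + 2 K c,
    d' = (2/n) c with c(0) = d(0) = 0. Hence
      Phi(s) = G(s) + c(t-s) A(s) + d(t-s) B(s)
    is nondecreasing: in Phi' the three lower bounds cancel against c' and d'.
    Comparing Phi(0) with Phi(t) = G(t) gives the estimate without any integral
    and without separating K = 0 ([gradient_estimate_pos]).

    Two points of analysis support this. A mean is one-homogeneous, hence
    theta(r, s) = s theta(r/s, 1) and all its differential calculus, including
    Euler's identity, is that of a function of one variable. And P_s rho stays
    positive, because P_s = e^(-s) e^(sQ) and e^(sQ) has nonnegative
    coefficients ([heat_gt0]).

    Densities with zeros are reached by applying the estimate to rho + e and
    letting e tend to 0 from the right, theta being continuous on the closed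
    quadrant ([gradient_estimate]). *)

(** * Calculus of finite sums and products *)

Lemma is_derive_mul {R : realType} (f g : R -> R) (s df dg : R) :
  is_derive s 1 f df -> is_derive s 1 g dg ->
  is_derive s 1 (fun u => f u * g u) (df * g s + f s * dg).
Proof.
move=> f' g'; have fg' : is_derive s 1 (f * g) _ := is_deriveM f' g'.
apply: (is_derive_eq fg').
by rewrite /GRing.scale /= addrC [g s * _]mulrC.
Qed.

Lemma is_derive_sqr {R : realType} (f : R -> R) (s df : R) :
  is_derive s 1 f df -> is_derive s 1 (fun u => f u ^+ 2) (2 * (f s * df)).
Proof.
move=> f'; have -> : (fun u => f u ^+ 2) = (fun u => f u * f u).
  by apply/funext => u; rewrite expr2.
by apply: (is_derive_eq (is_derive_mul f' f')); ring.
Qed.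

Lemma is_derive_mulr {R : realType} (f : R -> R) (c s df : R) :
  is_derive s 1 f df -> is_derive s 1 (fun u => f u * c) (df * c).
Proof.
move=> f'; apply: (is_derive_eq (is_derive_mul f' (is_derive_cst c s 1))).
by rewrite mulr0 addr0.
Qed.

Lemma is_derive_sub {R : realType} (f g : R -> R) (s df dg : R) :
  is_derive s 1 f df -> is_derive s 1 g dg ->
  is_derive s 1 (fun u => f u - g u) (df - dg).
Proof. exact: is_deriveB. Qed.

Section FiniteSums.
Context {R : realType} {I : finType}.

Lemma is_derive_fsum (h : I -> R -> R) (dh : I -> R) (s : R) :
  (forall i, is_derive s 1 (h i) (dh i)) ->
  is_derive s 1 (fun u => \sum_i h i u) (\sum_i dh i).
Proof.
move=> dh_h.
have -> : (fun u => \sum_i h i u) = \sum_i h i.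
  by apply/funext => u; rewrite fct_sumE.
elim/big_rec2: _ => [|i d g _ dg]; first exact: is_derive_cst.
exact: is_deriveD.
Qed.

Lemma cvg_fsum (T : Type) (F : set_system T) (h : I -> T -> R) (l : I -> R) :
  Filter F -> (forall i, h i x @[x --> F] --> l i) ->
  \sum_i h i x @[x --> F] --> \sum_i l i.
Proof. by move=> FF hl; apply: cvg_big => [|i _]; [exact: add_continuous|]. Qed.

End FiniteSums.

(** * Exponentials of operators on functions over a finite set *)

Definition kernel_op {R : realType} {X : finType} (M : X -> X -> R)
    (f : X -> R) : X -> R :=
  fun x => \sum_y M x y * f y.

(** With [L] the Laplacian this is the heat semigroup; the other case of
    interest is [L] the averaging operator of the transition kernel. *)
Definition op_exp {R : realType} {X : finType} (L : (X -> R) -> X -> R)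
    (t : R) (f : X -> R) : X -> R :=
  fun x => limn (series (fun k : nat => t ^+ k / (k`!)%:R * iter k L f x)).

Section OperatorExponential.
Context {R : realType} {X : finType} (M : X -> X -> R).

Local Notation L := (kernel_op M).

(* The sum of all entries is a crude bound, but one that works uniformly in
   the state. *)
Let C : R := \sum_x \sum_y `|M x y|.

Let C_ge0 : 0 <= C.
Proof. by apply: sumr_ge0 => x _; apply: sumr_ge0. Qed.

Lemma kernel_op_bounded (m : R) (f : X -> R) :
  (forall x, `|f x| <= m) -> forall x, `|L f x| <= C * m.
Proof.
move=> fm x; apply: le_trans (ler_norm_sum _ _ _) _.
have m0 : 0 <= m by apply: le_trans (fm x).
apply: (@le_trans _ _ (\sum_y `|M x y| * m)).
  by apply: ler_sum => y _; rewrite normrM ler_wpM2l.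
rewrite -mulr_suml ler_wpM2r// /C [leRHS](bigD1 x)//= lerDl.
by apply: sumr_ge0 => z _; apply: sumr_ge0.
Qed.

Lemma iter_kernel_op_bounded (f : X -> R) k x :
  `|iter k L f x| <= C ^+ k * \sum_y `|f y|.
Proof.
elim: k x => [|k IH] x /=; last by rewrite exprS -mulrA; apply: kernel_op_bounded.
by rewrite mul1r (bigD1 x)//= lerDl sumr_ge0.
Qed.

Lemma is_cvg_op_exp (t : R) (f : X -> R) x :
  cvgn (series (fun k => t ^+ k / (k`!)%:R * iter k L f x)).
Proof.
apply: normed_cvg.
pose m := \sum_y `|f y|.
apply: (@series_le_cvg _ _ (fun k => m * exp_coeff (`|t| * C) k)).
- by move=> k; exact: normr_ge0.
- move=> k; rewrite /exp_coeff /= mulr_ge0 ?sumr_ge0//.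
  by rewrite mulr_ge0// exprn_ge0// mulr_ge0.
- move=> k; rewrite /exp_coeff /= !normrM normrX normfV.
  rewrite (ger0_norm (ler0n _ _)) exprMn.
  have := iter_kernel_op_bounded f k x; rewrite -/m => H.
  rewrite [leRHS](_ : _ = `|t| ^+ k / k`!%:R * (C ^+ k * m)); last by ring.
  by apply: ler_wpM2l => //; rewrite mulr_ge0// exprn_ge0.
- exact: (is_cvg_seriesZ (k := m) (is_cvg_series_exp_coeff _)).
Qed.

Lemma kernel_opD_scale (f g : X -> R) (a : R) x :
  L (fun y => f y + a * g y) x = L f x + a * L g x.
Proof.
rewrite /kernel_op mulr_sumr -big_split /=.
by apply: eq_bigr => y _; ring.
Qed.

Lemma iter_kernel_opD_scale (f g : X -> R) (a : R) k :
  iter k L (fun y => f y + a * g y) =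
  (fun x => iter k L f x + a * iter k L g x).
Proof.
by elim: k => [//|k IH] /=; rewrite IH; apply/funext => x; apply: kernel_opD_scale.
Qed.

Lemma op_expD_scale (t a : R) (f g : X -> R) x :
  op_exp L t (fun y => f y + a * g y) x = op_exp L t f x + a * op_exp L t g x.
Proof.
apply: cvg_lim => //.
have -> : series (fun k => t ^+ k / k`!%:R * iter k L (fun y => f y + a * g y) x) =
    (fun n => series (fun k => t ^+ k / k`!%:R * iter k L f x) n
              + a * series (fun k => t ^+ k / k`!%:R * iter k L g x) n).
  apply/funext => n; rewrite !seriesEnat /= mulr_sumr -big_split /=.
  by apply: eq_bigr => k _; rewrite iter_kernel_opD_scale; ring.
apply: cvgD; first exact: is_cvg_op_exp.
by apply: cvgMl_tmp; apply: is_cvg_op_exp.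
Qed.

Lemma op_exp0 (f : X -> R) : op_exp L 0 f = f.
Proof.
apply/funext => x; apply: cvg_lim => //.
apply: cvg_near_cst; near=> n.
rewrite seriesEord /=.
have -> : n = n.-1.+1 by rewrite prednK//; near: n; exact: nbhs_infty_gt.
rewrite big_ord_recl /= expr0 fact0 divr1 mul1r big1 ?addr0// => i _.
by rewrite expr0n /= mul0r mul0r.
Unshelve. all: by end_near. Qed.

(** Partial sums commute with [L] because its powers do, and [L], being given by
    finite sums, passes to the limit. *)
Lemma op_exp_comm (t : R) (f : X -> R) : op_exp L t (L f) = L (op_exp L t f).
Proof.
apply/funext => x; apply: cvg_lim => //.
have -> : series (fun k => t ^+ k / k`!%:R * iter k L (L f) x) =
    (fun n => \sum_y M x y * series (fun k => t ^+ k / k`!%:R * iter k L f y) n).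
  apply/funext => n; rewrite seriesEnat /=.
  under [RHS]eq_bigr do rewrite seriesEnat /= mulr_sumr.
  rewrite exchange_big /=; apply: eq_bigr => k _.
  rewrite -iterSr iterS {1}/kernel_op mulr_sumr.
  by apply: eq_bigr => y _; ring.
by apply: cvg_fsum => y; apply: cvgMl_tmp; apply: is_cvg_op_exp.
Qed.

(** Termwise differentiation of a power series: the coefficients iter k L f x / k!
    turn into those of L f, so that the derivative is e^(sL) (L f). *)
Lemma is_derive_op_exp (f : X -> R) x (s : R) :
  is_derive s 1 (fun u => op_exp L u f x) (L (op_exp L s f) x).
Proof.
(* The coefficient sequence depends on g so that differentiating the series
   amounts to replacing g by L g. *)
pose c (g : X -> R) k := (k`!)%:R^-1 * iter k L g x.
have pc g u : pseries (c g) u =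
    series (fun k => u ^+ k / (k`!)%:R * iter k L g x).
  by congr series; apply/funext => k; rewrite /c /=; ring.
have dc g : pseries_diffs (c g) = c (L g).
  apply/funext => k; rewrite /pseries_diffs /c factS natrM invfM -iterSr.
  by rewrite mulrA mulrA mulfV ?mul1r// pnatr_eq0.
rewrite -op_exp_comm.
have -> : (fun u => op_exp L u f x) = (fun u => limn (pseries (c f) u)).
  by apply/funext => u; rewrite pc.
have -> : op_exp L s (L f) x = limn (pseries (pseries_diffs (c f)) s).
  by rewrite dc pc.
apply: (@pseries_snd_diffs _ _ (`|s| + 1)); rewrite ?dc ?pc.
- exact: is_cvg_op_exp.
- exact: is_cvg_op_exp.
- exact: is_cvg_op_exp.
- by rewrite [ltRHS]ger0_norm ?ltrDl// addr_ge0.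
Qed.

(** All terms of the series are nonnegative, and the one of index 0 is f x. *)
Lemma op_exp_pos_kernel_ge (f : X -> R) (t : R) x :
  (forall x y, 0 <= M x y) -> (forall x, 0 <= f x) -> 0 <= t ->
  f x <= op_exp L t f x.
Proof.
move=> M0 f0 t0.
have it0 k y : 0 <= iter k L f y.
  elim: k y => [//|k IH] y /=.
  by apply: sumr_ge0 => z _; rewrite mulr_ge0.
have nd : {homo series (fun k => t ^+ k / (k`!)%:R * iter k L f x) :
    n m / (n <= m)%N >-> n <= m}.
  apply/nondecreasing_seqP => k; rewrite !seriesEnat /= big_nat_recr//= lerDl.
  by rewrite mulr_ge0// divr_ge0// exprn_ge0.
have := nondecreasing_cvgn_le nd (@is_cvg_op_exp t f x) 1%N.
by rewrite {1}seriesEord /= big_ord1 /= expr0 fact0 divr1 mul1r.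
Qed.

End OperatorExponential.

(** * The heat semigroup: evolution equation, energy and positivity *)

Lemma is_derive_ge0_le {R : realType} (F dF : R -> R) (a b : R) : a <= b ->
  (forall s, a <= s <= b -> is_derive s 1 F (dF s)) ->
  (forall s, a <= s <= b -> 0 <= dF s) -> F a <= F b.
Proof.
move=> ab dFE dF0.
have oc s : s \in `]a, b[ -> a <= s <= b.
  by rewrite in_itv /= => /andP[/ltW -> /ltW ->].
apply: (@ger0_derive1_ndecr _ F a b) => //.
- by move=> s /oc /dFE [].
- by move=> s /oc sab; rewrite derive1E; have [_ ->] := dFE _ sab; apply: dF0.
- apply: derivable_within_continuous => s.
  by rewrite in_itv /= => /dFE [].
Qed.

Section HeatSemigroup.
Context {R : realType} {X : finType} (Q : X -> X -> R) (pi : X -> R).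
Hypothesis chain : markov_chain Q pi.

Local Notation Delta := (laplacian Q).

Lemma laplacianE : Delta = kernel_op (fun x y => Q x y - (x == y)%:R).
Proof.
apply/funext => f; apply/funext => x; rewrite /laplacian /kernel_op.
under eq_bigr do rewrite mulrBl.
under [RHS]eq_bigr do rewrite mulrBl.
rewrite !sumrB -mulr_sumr (markov_kernel_sum chain) mulr1; congr (_ - _).
  by apply: eq_bigr => y _; rewrite mulrC.
rewrite (bigD1 x)//= eqxx mul1r big1 ?addr0// => y.
by rewrite eq_sym => /negbTE ->; rewrite mul0r.
Qed.

Lemma laplacian_kernelE (f : X -> R) x : Delta f x = kernel_op Q f x - f x.
Proof.
rewrite /laplacian; under eq_bigr do rewrite mulrBl.
rewrite sumrB -mulr_sumr (markov_kernel_sum chain) mulr1; congr (_ - _).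
by apply: eq_bigr => y _; rewrite mulrC.
Qed.

Lemma heat0 (f : X -> R) : heat Q 0 f = f.
Proof. by rewrite /heat laplacianE; apply: op_exp0. Qed.

Lemma heatD_scale (t a : R) (f g : X -> R) x :
  heat Q t (fun y => f y + a * g y) x = heat Q t f x + a * heat Q t g x.
Proof. by rewrite /heat laplacianE; apply: op_expD_scale. Qed.

Lemma is_derive_heat (f : X -> R) x (s : R) :
  is_derive s 1 (fun u => heat Q u f x) (Delta (heat Q s f) x).
Proof. by rewrite /heat laplacianE; apply: is_derive_op_exp. Qed.

Lemma is_derive_laplacian (g : R -> X -> R) (dg : X -> R) (s : R) :
  (forall x, is_derive s 1 (g ^~ x) (dg x)) ->
  forall x, is_derive s 1 (fun u => Delta (g u) x) (Delta dg x).
Proof.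
move=> g' x; apply: is_derive_fsum => y.
by apply: is_derive_mulr; apply: is_derive_sub.
Qed.

(** Q(x,y) pi(x) is symmetric in x and y, so the variables of a double sum
    against it can be exchanged; every symmetrization below goes through this. *)
Lemma reversible_sum (F : X -> X -> R) :
  \sum_x \sum_y F x y * Q x y * pi x = \sum_x \sum_y F y x * Q x y * pi x.
Proof.
rewrite exchange_big; apply: eq_bigr => x _; apply: eq_bigr => y _.
by rewrite -!mulrA (markov_reversible chain).
Qed.

Lemma laplacian_sym (f g : X -> R) : inner pi f (Delta g) = inner pi (Delta f) g.
Proof.
have E (h k : X -> R) : inner pi h (Delta k) =
    \sum_x \sum_y h x * k y * Q x y * pi x - \sum_x \sum_y h x * k x * Q x y * pi x.
  rewrite -sumrB; apply: eq_bigr => x _.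
  rewrite mulr_sumr mulr_suml -sumrB; apply: eq_bigr => y _; ring.
rewrite E reversible_sum.
have -> : inner pi (Delta f) g = inner pi g (Delta f).
  by apply: eq_bigr => x _; rewrite [g x * _]mulrC.
rewrite E; congr (_ - _); apply: eq_bigr => x _; apply: eq_bigr => y _;
  by rewrite [f _ * _]mulrC.
Qed.

(** By self-adjointness the left-hand side integrates Delta(g^2) - 2 g Delta g,
    that is, twice the carre du champ of g, against r. *)
Lemma laplacian_carre_du_champ (r g : X -> R) :
  inner pi (fun x => g x ^+ 2) (Delta r) - 2 * inner pi (fun x => g x * Delta g x) r =
  \sum_x \sum_y r x * (g y - g x) ^+ 2 * Q x y * pi x.
Proof.
rewrite laplacian_sym /inner mulr_sumr -sumrB; apply: eq_bigr => x _.
rewrite !mulr_suml !mulr_sumr !mulr_suml mulr_sumr -sumrB.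
by apply: eq_bigr => y _; ring.
Qed.

Lemma carre_du_champ_ge0 (r g : X -> R) : (forall x, 0 <= r x) ->
  0 <= \sum_x \sum_y r x * (g y - g x) ^+ 2 * Q x y * pi x.
Proof.
move=> r0; apply: sumr_ge0 => x _; apply: sumr_ge0 => y _.
have /andP[Q0 _] := markov_kernel_ge0_le1 chain x y.
have /andP[/ltW pi0 _] := markov_measure_gt0_le1 chain x.
by do 3!apply: mulr_ge0 => //; apply: sqr_ge0.
Qed.

Lemma is_derive_inner_sqr (g r : R -> X -> R) (dg dr : X -> R) (s : R) :
  (forall x, is_derive s 1 (g ^~ x) (dg x)) ->
  (forall x, is_derive s 1 (r ^~ x) (dr x)) ->
  is_derive s 1 (fun u => inner pi (fun x => g u x ^+ 2) (r u))
    (inner pi (fun x => g s x ^+ 2) dr + 2 * inner pi (fun x => g s x * dg x) (r s)).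
Proof.
move=> g' r'.
have -> : inner pi (fun x => g s x ^+ 2) dr + 2 * inner pi (fun x => g s x * dg x) (r s)
    = \sum_x (g s x ^+ 2 * dr x + 2 * (g s x * dg x) * r s x) * pi x.
  by rewrite mulr_sumr -big_split; apply: eq_bigr => x _ /=; ring.
apply: is_derive_fsum => x.
have g2r := is_derive_mul (is_derive_sqr (g' x)) (r' x).
apply: (is_derive_eq (is_derive_mulr (pi x) g2r)).
by ring.
Qed.

(** Energy method: the derivative of the squared norm of w is minus a sum of
    squares, so the norm cannot leave the value 0. *)
Lemma laplacian_flow_eq0 (w : R -> X -> R) (s : R) :
  (forall (u : R) x, is_derive u 1 (w ^~ x) (Delta (w u) x)) ->
  (forall x, w 0 x = 0) -> 0 <= s -> forall x, w s x = 0.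
Proof.
move=> w' w0 s0 x.
pose N u := inner pi (fun x => w u x ^+ 2) (cst 1).
have N' (u : R) : is_derive u 1 (fun v => - N v)
    (\sum_x \sum_y (cst 1 : X -> R) x * (w u y - w u x) ^+ 2 * Q x y * pi x).
  have one' (y : X) : is_derive u 1 (fun _ : R => (cst 1 : X -> R) y) 0.
    exact: is_derive_cst.
  have H := is_deriveN (is_derive_inner_sqr (w' u) one').
  apply: (is_derive_eq H).
  rewrite -laplacian_carre_du_champ opprD; congr (_ - _).
  rewrite -sumrN; apply: eq_bigr => y _.
  rewrite /laplacian [X in _ = _ * X * _]big1 ?mulr0 ?mul0r ?oppr0// => z _.
  by rewrite /= subrr mul0r.
have : - N 0 <= - N s.
  apply: (is_derive_ge0_le (F := fun v => - N v) s0) => u _.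
  exact: carre_du_champ_ge0.
have -> : N 0 = 0 by rewrite /N /inner big1// => y _; rewrite w0 expr0n /= !mul0r.
rewrite oppr0 oppr_ge0 => Ns.
have t0 y : 0 <= w s y ^+ 2 * (cst 1 : X -> R) y * pi y.
  have /andP[/ltW pi0 _] := markov_measure_gt0_le1 chain y.
  by rewrite /= mulr1 mulr_ge0 ?sqr_ge0.
have /eqP : N s = 0 by apply: le_anti; rewrite Ns sumr_ge0.
rewrite psumr_eq0// => /allP /(_ x (mem_index_enum x)) /=.
have /andP[pi0 _] := markov_measure_gt0_le1 chain x.
by rewrite mulr1 mulf_eq0 (gt_eqF pi0) orbF sqrf_eq0 => /eqP.
Qed.

(** Since Delta = Q - I, the right-hand side solves the same evolution equation as
    the heat semigroup, with the same initial value; uniqueness identifies them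
    without multiplying the two exponential series. *)
Lemma heat_exp_kernelE (f : X -> R) (s : R) x : 0 <= s ->
  heat Q s f x = expR (- s) * op_exp (kernel_op Q) s f x.
Proof.
move=> s0.
pose v u y := expR (- u) * op_exp (kernel_op Q) u f y.
apply/eqP; rewrite -subr_eq0; apply/eqP.
apply: (@laplacian_flow_eq0 (fun u y => heat Q u f y - v u y)) => //; last first.
  by move=> y; rewrite /v heat0 op_exp0 oppr0 expR0 mul1r subrr.
move=> u y.
have v' : is_derive u 1 (v ^~ y) (Delta (v u) y).
  have eN : is_derive u 1 (fun t : R => expR (- t)) (- expR (- u)).
    have := is_derive1_comp (is_derive_expR (- u)) (is_deriveNid u (1 : R)).
    by rewrite mulrN1.
  apply: (is_derive_eq (is_derive_mul eN (is_derive_op_exp Q f y u))).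
  rewrite laplacian_kernelE mulNr addrC; congr (_ - _).
  by rewrite /kernel_op mulr_sumr; apply: eq_bigr => z _; rewrite /v; ring.
apply: (is_derive_eq (is_derive_sub (is_derive_heat f y u) v')).
by rewrite -sumrB; apply: eq_bigr => z _; ring.
Qed.

(** The exponential of a nonnegative kernel dominates its initial value, which
    makes positivity visible in [heat_exp_kernelE]; the series of the Laplacian
    has terms of both signs. *)
Lemma heat_gt0 (f : X -> R) (s : R) x : (forall y, 0 < f y) -> 0 <= s ->
  0 < heat Q s f x.
Proof.
move=> f0 s0; rewrite heat_exp_kernelE// mulr_gt0 ?expR_gt0//.
apply: lt_le_trans (f0 x) _; apply: op_exp_pos_kernel_ge => //.
- by move=> y z; have /andP[] := markov_kernel_ge0_le1 chain y z.
- by move=> y; exact/ltW.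
Qed.

End HeatSemigroup.

(** * Differentiating a homogeneous mean *)

Section MeanDerivative.
Context {R : realType} (theta : R -> R -> R).
Hypothesis mean_theta : mean theta.

Local Notation phi' z := (derive1 (theta ^~ 1) z).

(** Homogeneity reduces theta to the function theta(., 1) of one variable. *)
Lemma mean_perspective (r s : R) : 0 < r -> 0 < s ->
  theta r s = s * theta (r / s) 1.
Proof.
move=> r0 s0; rewrite -(mean_homogeneous mean_theta)// ?divr_ge0 ?ltW//.
by rewrite mulr1 mulrC divfK// gt_eqF.
Qed.

(** The chain rule in one variable for v theta(u/v, 1). Both partial derivatives of
    theta are read off from it by freezing u or v. *)
Lemma is_derive_mean_perspective (u v : R -> R) (t du dv : R) :
  is_derive t 1 u du -> is_derive t 1 v dv -> 0 < u t -> 0 < v t ->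
  is_derive t 1 (fun a => theta (u a) (v a))
    (phi' (u t / v t) * du +
     (theta (u t / v t) 1 - phi' (u t / v t) * (u t / v t)) * dv).
Proof.
move=> u' v' ut vt.
have pos (w : R -> R) dw : is_derive t 1 w dw -> 0 < w t -> \forall a \near t, 0 < w a.
  move=> w' wt; have cw : {for t, continuous w}.
    by apply/differentiable_continuous/derivable1_diffP; case: w'.
  exact: (cvgr_gt _ cw).
have : \forall a \near t, v a * theta (u a / v a) 1 = theta (u a) (v a).
  near=> a; rewrite -mean_perspective//; near: a; [exact: pos u' _|exact: pos v' _].
move=> /near_eq_is_derive; apply.
have z0 : 0 < u t / v t by rewrite divr_gt0.
have phiE : is_derive (u t / v t) 1 (theta ^~ 1) (phi' (u t / v t)).
  have [_ [/(_ _ 1 z0 ltr01)[dphi _] _ _]] := mean_smooth mean_theta 1.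
  by apply: DeriveDef => //; rewrite derive1E.
have vV : is_derive t 1 (fun a => (v a)^-1) (- v t ^- 2 * dv).
  by apply: is_deriveV => //; rewrite gt_eqF.
have comp := is_derive1_comp (g := fun a => u a / v a) phiE (is_derive_mul u' vV).
apply: (is_derive_eq (is_derive_mul v' comp)).
by rewrite /=; field; rewrite gt_eqF.
Unshelve. all: by end_near. Qed.

Lemma partial1_perspective (r s : R) : 0 < r -> 0 < s ->
  partial1 theta r s = phi' (r / s).
Proof.
move=> r0 s0; rewrite /partial1 r0 /partial1of2 derive1E.
have H := is_derive_mean_perspective (is_derive_id r 1) (is_derive_cst s r 1) r0 s0.
by have [_ ->] := H; rewrite mulr1 mulr0 addr0.
Qed.

Lemma partial1_swap_perspective (r s : R) : 0 < r -> 0 < s ->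
  partial1 theta s r = theta (r / s) 1 - phi' (r / s) * (r / s).
Proof.
move=> r0 s0; rewrite /partial1 s0 /partial1of2 derive1E.
have H := is_derive_mean_perspective (is_derive_cst r s 1) (is_derive_id s 1) r0 s0.
have : \forall a \near s, theta r a = theta a r.
  near=> a; rewrite (mean_symmetric mean_theta) ?ltW//; near: a; exact: lt_nbhsr.
move=> /near_eq_is_derive /(_ H) [_ ->].
by rewrite mulr1 mulr0 add0r.
Unshelve. all: by end_near. Qed.

(** Euler's identity for the one-homogeneous theta; by symmetry of theta the second
    partial derivative at (r, s) is the first one at (s, r). *)
Lemma mean_euler (r s : R) : 0 < r -> 0 < s ->
  r * partial1 theta r s + s * partial1 theta s r = theta r s.
Proof.
move=> r0 s0; rewrite partial1_perspective// partial1_swap_perspective//.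
by rewrite [theta r s]mean_perspective//; field; rewrite gt_eqF.
Qed.

Lemma is_derive_mean (u v : R -> R) (t du dv : R) :
  is_derive t 1 u du -> is_derive t 1 v dv -> 0 < u t -> 0 < v t ->
  is_derive t 1 (fun a => theta (u a) (v a))
    (partial1 theta (u t) (v t) * du + partial1 theta (v t) (u t) * dv).
Proof.
move=> u' v' ut vt.
rewrite partial1_perspective// partial1_swap_perspective//.
exact: is_derive_mean_perspective.
Qed.

End MeanDerivative.

(** * The modified Gamma calculus and the action functional *)

Section ModifiedGamma.
Context {R : realType} {X : finType} (Q : X -> X -> R) (pi : X -> R).
Context (theta : R -> R -> R).
Hypotheses (chain : markov_chain Q pi) (mean_theta : mean theta).

Local Notation Delta := (laplacian Q).

Lemma Gamma_rhoE (rho f g : X -> R) x : Gamma_rho Q theta rho f g x =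
  \sum_y partial1 theta (rho x) (rho y) * (f y - f x) * (g y - g x) * Q x y.
Proof.
rewrite /Gamma_rho /laplacian_rho !mulr_sumr -!sumrB mulr_sumr.
by apply: eq_bigr => y _ /=; field.
Qed.

(** Symmetrizing turns the factor rho(x) partial1 theta into the left-hand side of
    Euler's identity, which restores theta itself. *)
Lemma inner_Gamma_rho (rho f g : X -> R) : (forall x, 0 < rho x) ->
  inner pi rho (Gamma_rho Q theta rho f g) = 2^-1 * \sum_x \sum_y
    theta (rho x) (rho y) * (f y - f x) * (g y - g x) * Q x y * pi x.
Proof.
move=> rho0.
pose F x y := rho x * partial1 theta (rho x) (rho y) * (f y - f x) * (g y - g x).
have E : inner pi rho (Gamma_rho Q theta rho f g) =
    \sum_x \sum_y F x y * Q x y * pi x.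
  apply: eq_bigr => x _; rewrite Gamma_rhoE mulr_sumr mulr_suml.
  by apply: eq_bigr => y _; rewrite /F; ring.
have -> : inner pi rho (Gamma_rho Q theta rho f g) = 2^-1 *
    (\sum_x \sum_y F x y * Q x y * pi x + \sum_x \sum_y F y x * Q x y * pi x).
  by rewrite -(reversible_sum chain F) E; field.
congr (_ * _); rewrite -big_split; apply: eq_bigr => x _ /=.
rewrite -big_split; apply: eq_bigr => y _ /=.
by rewrite -(mean_euler mean_theta (rho0 x) (rho0 y)) /F; ring.
Qed.

Lemma action_functionalE (rho f : X -> R) : (forall x, 0 < rho x) ->
  action_functional Q pi theta rho f = inner pi rho (Gamma_rho Q theta rho f f).
Proof.
move=> rho0; rewrite inner_Gamma_rho//; congr (_ * _).
by apply: eq_bigr => x _; apply: eq_bigr => y _; ring.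
Qed.

(** When the density follows the heat flow forwards and the function follows it
    backwards, the action grows at twice the rate <r, Gamma_2>: the motion of
    the density contributes <Delta r, Gamma_r g>, which is <r, Delta Gamma_r g> by
    self-adjointness, and the motion of the function contributes
    - 2 <r, Gamma_r(g, Delta g)>. *)
Lemma is_derive_action (r g : R -> X -> R) (s : R) :
  (forall x, is_derive s 1 (r ^~ x) (Delta (r s) x)) ->
  (forall x, is_derive s 1 (g ^~ x) (- Delta (g s) x)) ->
  (forall x, 0 < r s x) ->
  is_derive s 1 (fun u => action_functional Q pi theta (r u) (g u))
    (2 * inner pi (r s) (Gamma2_rho Q theta (r s) (g s) (g s))).
Proof.
move=> r' g' r0.
set rho := r s; set f := g s.
pose p x y := partial1 theta (rho x) (rho y).
(* The first summand comes from the motion of the density, the second one from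
   that of the function. *)
pose A' x y := (p x y * Delta rho x + p y x * Delta rho y) * (f y - f x) ^+ 2
  - 2 * (theta (rho x) (rho y) * (f y - f x) * (Delta f y - Delta f x)).
have act' : is_derive s 1 (fun u => action_functional Q pi theta (r u) (g u))
    (2^-1 * \sum_x \sum_y A' x y * Q x y * pi x).
  have S : is_derive s 1 (fun u => \sum_x \sum_y
        theta (r u x) (r u y) * (g u y - g u x) ^+ 2 * Q x y * pi x)
      (\sum_x \sum_y A' x y * Q x y * pi x).
    apply: is_derive_fsum => x; apply: is_derive_fsum => y.
    have th := is_derive_mean mean_theta (r' x) (r' y) (r0 x) (r0 y).
    have g2 := is_derive_sqr (is_derive_sub (g' y) (g' x)).
    have H := is_derive_mulr (pi x) (is_derive_mulr (Q x y) (is_derive_mul th g2)).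
    apply: (is_derive_eq H).
    by rewrite /A' /p -/rho -/f; ring.
  have H := is_derive_mul (is_derive_cst (2^-1 : R) s 1) S.
  by apply: (is_derive_eq H); rewrite mul0r add0r.
apply: (is_derive_eq act').
have -> : 2 * inner pi rho (Gamma2_rho Q theta rho f f) =
    inner pi (Delta rho) (Gamma_rho Q theta rho f f)
    - 2 * inner pi rho (Gamma_rho Q theta rho f (Delta f)).
  rewrite -(laplacian_sym chain) /inner !mulr_sumr -sumrB.
  by apply: eq_bigr => x _; rewrite /Gamma2_rho; field.
rewrite inner_Gamma_rho// mulVKf//.
pose F x y := p x y * Delta rho x * (f y - f x) ^+ 2.
have -> : inner pi (Delta rho) (Gamma_rho Q theta rho f f) = 2^-1 *
    (\sum_x \sum_y F x y * Q x y * pi x + \sum_x \sum_y F y x * Q x y * pi x).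
  have half (a : R) : 2^-1 * (a + a) = a by field.
  rewrite -(reversible_sum chain F) half.
  apply: eq_bigr => x _; rewrite Gamma_rhoE mulr_sumr mulr_suml.
  by apply: eq_bigr => y _; rewrite /F /p; ring.
set S2 := (X in _ - X).
have -> : S2 = 2^-1 * (2 * S2) by rewrite mulKf.
rewrite -mulrBr; congr (_ * _); rewrite /S2 mulr_sumr -big_split -sumrB.
apply: eq_bigr => x _; rewrite mulr_sumr -big_split -sumrB.
by apply: eq_bigr => y _; rewrite /A' /F /=; ring.
Qed.

Lemma CD_action_growth (K : R) (n : \bar R) (rho f : X -> R) :
  CD Q pi theta K n -> (forall x, 0 < rho x) ->
  2 * K * action_functional Q pi theta rho f
    + 2 * inv_dim n * inner pi rho (fun x => Delta f x ^+ 2)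
  <= 2 * inner pi rho (Gamma2_rho Q theta rho f f).
Proof.
move=> cd rho0.
have dom x : mean_domain theta (rho x).
  by rewrite /mean_domain; case: ifP => _ /=; rewrite ?ltW.
have := cd rho f dom.
have -> : inner pi rho (fun x => Gamma2_rho Q theta rho f f x
      - inv_dim n * Delta f x ^+ 2 - K * Gamma_rho Q theta rho f f x) =
    inner pi rho (Gamma2_rho Q theta rho f f)
    - inv_dim n * inner pi rho (fun x => Delta f x ^+ 2)
    - K * action_functional Q pi theta rho f.
  rewrite action_functionalE// /inner !mulr_sumr -!sumrB.
  by apply: eq_bigr => x _; ring.
by move=> H; lra.
Qed.

(** By symmetrization the right-hand side is twice the action for the arithmetic
    mean. *)
Lemma action_le_carre_du_champ (rho f : X -> R) :
  (forall r s : R, 0 <= r -> 0 <= s -> theta r s <= theta_a r s) ->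
  (forall x, 0 < rho x) ->
  2 * action_functional Q pi theta rho f <=
  \sum_x \sum_y rho x * (f y - f x) ^+ 2 * Q x y * pi x.
Proof.
move=> theta_le rho0; rewrite /action_functional mulVKf//.
pose F x y := rho x * (f y - f x) ^+ 2.
have -> : \sum_x \sum_y rho x * (f y - f x) ^+ 2 * Q x y * pi x =
    \sum_x \sum_y theta_a (rho x) (rho y) * (f y - f x) ^+ 2 * Q x y * pi x.
  have -> : \sum_x \sum_y rho x * (f y - f x) ^+ 2 * Q x y * pi x = 2^-1 *
      (\sum_x \sum_y F x y * Q x y * pi x + \sum_x \sum_y F y x * Q x y * pi x).
    by rewrite -(reversible_sum chain F) /F; field.
  rewrite -big_split mulr_sumr; apply: eq_bigr => x _ /=.
  rewrite -big_split mulr_sumr; apply: eq_bigr => y _ /=.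
  by rewrite /F /theta_a; field.
apply: ler_sum => x _; apply: ler_sum => y _.
have /andP[Q0 _] := markov_kernel_ge0_le1 chain x y.
have /andP[/ltW pi0 _] := markov_measure_gt0_le1 chain x.
do 3!apply: ler_wpM2r => //; first exact: sqr_ge0.
by apply: theta_le; exact/ltW.
Qed.

End ModifiedGamma.

(** * The two time-dependent coefficients *)

Section Coefficients.
Context {R : realType}.

Lemma gradient_coeff0 (K : R) : gradient_coeff K 0 = 0.
Proof. by rewrite /gradient_coeff !mulr0 expR0 subrr mul0r if_same. Qed.

Lemma dimension_coeff0 (K : R) (n : \bar R) : dimension_coeff K n 0 = 0.
Proof.
by rewrite /dimension_coeff !mulr0 expR0 subrr mul0r expr0n /=
  !(mulr0, mul0r, subrr) if_same.
Qed.

(** Together with [is_derive_gradient_coeff], this is the differential equation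
    c' = 2 + 2 K c, in a form that covers K = 0. *)
Lemma mul_gradient_coeff (K t : R) :
  K * gradient_coeff K t = expR (2 * K * t) - 1.
Proof.
rewrite /gradient_coeff; case: eqVneq => [->|K0]; last by rewrite mulrC divfK.
by rewrite !(mulr0, mul0r) expR0 subrr.
Qed.

Let is_derive_expRM (K t : R) :
  is_derive t 1 (fun u => expR (2 * K * u)) (expR (2 * K * t) * (2 * K)).
Proof.
have lin : is_derive t 1 (fun u : R => 2 * K * u) (2 * K).
  apply: (is_derive_eq (is_derive_mul (is_derive_cst (2 * K) t 1) (is_derive_id t 1))).
  by rewrite mul0r add0r mulr1.
exact: (is_derive1_comp (g := fun u => 2 * K * u) (is_derive_expR _) lin).
Qed.

Lemma is_derive_gradient_coeff (K t : R) :
  is_derive t 1 (gradient_coeff K) (2 * expR (2 * K * t)).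
Proof.
have [->|K0] := eqVneq K 0.
  have -> : gradient_coeff 0 = (fun u : R => u * 2).
    by apply/funext => u; rewrite /gradient_coeff eqxx mulrC.
  apply: (is_derive_eq (is_derive_mulr 2 (is_derive_id t 1))).
  by rewrite mulr0 mul0r expR0 mul1r mulr1.
have -> : gradient_coeff K = (fun u => (expR (2 * K * u) - 1) * K^-1).
  by apply/funext => u; rewrite /gradient_coeff (negbTE K0).
have H := is_derive_sub (is_derive_expRM K t) (is_derive_cst (1 : R) t 1).
by apply: (is_derive_eq (is_derive_mulr K^-1 H)); field.
Qed.

Lemma is_derive_dimension_coeff (K : R) (n : \bar R) (t : R) :
  is_derive t 1 (dimension_coeff K n) (2 * inv_dim n * gradient_coeff K t).
Proof.
have [K0|K0] := eqVneq K 0.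
  have -> : dimension_coeff K n = (fun u => u ^+ 2 * (2 * inv_dim n)).
    by apply/funext => u; rewrite /dimension_coeff K0 eqxx; ring.
  apply: (is_derive_eq (is_derive_mulr _ (is_derive_sqr (is_derive_id t 1)))).
  by rewrite /gradient_coeff K0 eqxx; ring.
have -> : dimension_coeff K n =
    (fun u => (gradient_coeff K u - u * 2) * (K^-1 * inv_dim n)).
  by apply/funext => u; rewrite /dimension_coeff /gradient_coeff (negbTE K0); ring.
have H := is_derive_sub (is_derive_gradient_coeff K t)
  (is_derive_mulr 2 (is_derive_id t 1)).
apply: (is_derive_eq (is_derive_mulr _ H)).
by rewrite /gradient_coeff (negbTE K0); field.
Qed.

Lemma gradient_coeff_ge0 (K t : R) : 0 <= t -> 0 <= gradient_coeff K t.
Proof.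
move=> t0; rewrite -(gradient_coeff0 K).
apply: (is_derive_ge0_le t0) => s _; first exact: is_derive_gradient_coeff.
by rewrite mulr_ge0// expR_ge0.
Qed.

Lemma inv_dim_ge0 (n : \bar R) : (0 < n)%E -> 0 <= inv_dim n.
Proof. by move=> n0; apply: fine_ge0; rewrite inve_ge0 ltW. Qed.

Lemma dimension_coeff_ge0 (K : R) (n : \bar R) (t : R) :
  (0 < n)%E -> 0 <= t -> 0 <= dimension_coeff K n t.
Proof.
move=> n0 t0; rewrite -(dimension_coeff0 K n).
apply: (is_derive_ge0_le t0) => s; first by move=> _; exact: is_derive_dimension_coeff.
move=> /andP[s0 _]; rewrite mulr_ge0 ?gradient_coeff_ge0//.
by rewrite mulr_ge0 ?inv_dim_ge0.
Qed.

End Coefficients.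

(** * The estimate for positive densities *)

Section GradientEstimate.
Context {R : realType} {X : finType} (Q : X -> X -> R) (pi : X -> R).
Context (theta : R -> R -> R) (K : R) (n : \bar R).
Hypotheses (chain : markov_chain Q pi) (mean_theta : mean theta).
Hypothesis theta_le : forall r s : R, 0 <= r -> 0 <= s -> theta r s <= theta_a r s.
Hypotheses (n_gt0 : (0 < n)%E) (cd : CD Q pi theta K n).

Local Notation Delta := (laplacian Q).
Local Notation P := (heat Q).
Local Notation c := (gradient_coeff K).
Local Notation d := (dimension_coeff K n).

(** Monotonicity of the interpolation G(s) + c(t-s) A(s) + d(t-s) B(s). *)
Lemma gradient_estimate_pos (rho f : X -> R) (t : R) :
  (forall x, 0 < rho x) -> 0 <= t ->
  inner pi (fun x => P t f x ^+ 2) rho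
    + c t * action_functional Q pi theta rho (P t f)
    + d t * inner pi (fun x => Delta (P t f) x ^+ 2) rho
  <= inner pi (fun x => f x ^+ 2) (P t rho).
Proof.
move=> rho0 t0.
pose g s := P (t - s) f; pose r s := P s rho.
pose G s := inner pi (fun x => g s x ^+ 2) (r s).
pose A s := action_functional Q pi theta (r s) (g s).
pose B s := inner pi (fun x => Delta (g s) x ^+ 2) (r s).
pose E s (h : X -> R) := \sum_x \sum_y r s x * (h y - h x) ^+ 2 * Q x y * pi x.
have ts (s : R) : is_derive s 1 (fun u => t - u) (- 1).
  apply: (is_derive_eq (is_derive_sub (is_derive_cst t s 1) (is_derive_id s 1))).
  by rewrite sub0r.
have r' (s : R) x : is_derive s 1 (r ^~ x) (Delta (r s) x).
  exact: (is_derive_heat chain).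
have g' (s : R) x : is_derive s 1 (g ^~ x) (- Delta (g s) x).
  have H := is_derive1_comp (g := fun u => t - u)
    (is_derive_heat chain f x (t - s)) (ts s).
  by apply: (is_derive_eq H); rewrite mulrN1.
have Dg' (s : R) x : is_derive s 1 (fun u => Delta (g u) x) (- Delta (Delta (g s)) x).
  apply: (is_derive_eq (is_derive_laplacian Q (g' s) x)).
  move: (Delta (g s)) => h; rewrite /laplacian -sumrN.
  by apply: eq_bigr => y _; ring.
have flow (h : R -> X -> R) (s : R) :
    (forall x, is_derive s 1 (h ^~ x) (- Delta (h s) x)) ->
    is_derive s 1 (fun u => inner pi (fun x => h u x ^+ 2) (r u)) (E s (h s)).
  move=> h'; apply: (is_derive_eq (is_derive_inner_sqr pi h' (r' s))).
  rewrite /E -(laplacian_carre_du_champ chain); congr (_ + _).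
  rewrite -mulrN; congr (_ * _); rewrite /inner -sumrN.
  by apply: eq_bigr => x _; ring.
have G' (s : R) : is_derive s 1 G (E s (g s)) by exact: flow.
have B' (s : R) : is_derive s 1 B (E s (Delta (g s))).
  exact: (flow (fun u => Delta (g u))).
have r0 s x : 0 <= s -> 0 < r s x by exact: (heat_gt0 chain).
have A' (s : R) : 0 <= s -> is_derive s 1 A
    (2 * inner pi (r s) (Gamma2_rho Q theta (r s) (g s) (g s))).
  by move=> s0; apply: is_derive_action => // x; exact: r0.
have c' (s : R) : is_derive s 1 (fun u => c (t - u)) (- (2 * expR (2 * K * (t - s)))).
  have H := is_derive1_comp (g := fun u => t - u)
    (is_derive_gradient_coeff K (t - s)) (ts s).
  by apply: (is_derive_eq H); rewrite mulrN1.
have d' (s : R) : is_derive s 1 (fun u => d (t - u)) (- (2 * inv_dim n * c (t - s))).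
  have H := is_derive1_comp (g := fun u => t - u)
    (is_derive_dimension_coeff K n (t - s)) (ts s).
  by apply: (is_derive_eq H); rewrite mulrN1.
have Phi_le : G 0 + c (t - 0) * A 0 + d (t - 0) * B 0
    <= G t + c (t - t) * A t + d (t - t) * B t.
  apply: (is_derive_ge0_le (F := fun s => G s + c (t - s) * A s + d (t - s) * B s) t0).
    move=> s /andP[s0 st].
    exact: is_deriveD (is_deriveD (G' s) (is_derive_mul (c' s) (A' s s0)))
                      (is_derive_mul (d' s) (B' s)).
  move=> s /andP[s0 st].
  have rs0 x : 0 < r s x by exact: r0.
  have c0 : 0 <= c (t - s) by rewrite gradient_coeff_ge0// subr_ge0.
  have d0 : 0 <= d (t - s) by rewrite dimension_coeff_ge0// subr_ge0.
  have EA := action_le_carre_du_champ chain (g s) theta_le rs0.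
  have EB : 0 <= E s (Delta (g s)).
    by apply: (carre_du_champ_ge0 chain) => x; exact/ltW.
  have := CD_action_growth chain mean_theta (g s) cd rs0.
  have -> : inner pi (r s) (fun x => Delta (g s) x ^+ 2) = B s.
    by apply: eq_bigr => x _; rewrite [r s x * _]mulrC.
  move=> /(ler_wpM2l c0) growth.
  have dB : 0 <= d (t - s) * E s (Delta (g s)) by rewrite mulr_ge0.
  have Kc := mul_gradient_coeff K (t - s).
  rewrite -/(A s) -/(E s (g s)) in EA growth *.
  (* With the derivative of c written as 2 + 2 K c, the goal is the sum of the
     inequalities [EA], [growth] and [dB]. *)
  have -> : expR (2 * K * (t - s)) = K * c (t - s) + 1 by rewrite Kc subrK.
  nra.
move: Phi_le; rewrite subr0 subrr gradient_coeff0 dimension_coeff0 !mul0r !addr0.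
have g0 : g 0 = P t f by rewrite /g subr0.
have gt : g t = f by rewrite /g subrr (heat0 chain).
have re : r 0 = rho by rewrite /r (heat0 chain).
by rewrite /G /A /B g0 gt re.
Qed.

End GradientEstimate.

(** * Densities with zeros *)

Section BoundaryDensities.
Context {R : realType} {X : finType} (Q : X -> X -> R) (pi : X -> R).
Context (theta : R -> R -> R).
Hypothesis mean_theta : mean theta.

Lemma cvg_affine0 (a b : R) : a + e * b @[e --> 0^'+] --> a.
Proof.
have -> : nbhs a = nbhs (a + 0 * b) by rewrite mul0r addr0.
have e0 : e @[e --> (0 : R)^'+] --> (0 : R).
  by apply: cvg_at_right_filter; exact: cvg_id.
apply: cvgD; first exact: cvg_cst.
exact: cvgMr_tmp e0.
Qed.

(** Shifting by e > 0 stays in the closed quadrant, where theta is continuous. *)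
Lemma cvg_mean_shift (r s : R) : 0 <= r -> 0 <= s ->
  theta (r + e * 1) (s + e * 1) @[e --> 0^'+] --> theta r s.
Proof.
move=> r0 s0.
have /subspace_continuousP/(_ (r, s) (conj r0 s0)) := mean_continuous mean_theta.
move=> theta_c U /theta_c thU.
have lim2 : (r + e * 1, s + e * 1) @[e --> 0^'+] --> (r, s).
  exact: (cvg_pair (@cvg_affine0 r 1) (@cvg_affine0 s 1)).
have := lim2 _ thU; rewrite /= !near_simpl => near_U.
near=> e.
have e0 : 0 < e by near: e; exact: nbhs_right_gt.
have : [set p : R * R | 0 <= p.1 /\ 0 <= p.2] (r + e * 1, s + e * 1).
  by split; rewrite /= mulr1 addr_ge0// ltW.
by near: e; apply: filterS near_U => e.
Unshelve. all: by end_near. Qed.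

Lemma cvg_action_shift (rho f : X -> R) : (forall x, 0 <= rho x) ->
  action_functional Q pi theta (fun x => rho x + e * 1) f @[e --> 0^'+]
  --> action_functional Q pi theta rho f.
Proof.
move=> rho0; apply: cvgMl_tmp.
apply: cvg_fsum => x; apply: cvg_fsum => y.
by do 3!apply: cvgMr_tmp; apply: cvg_mean_shift.
Qed.

End BoundaryDensities.

Lemma innerD_scale {R : realType} {X : finType} (pi f g h : X -> R) (a : R) :
  inner pi f (fun x => g x + a * h x) = inner pi f g + a * inner pi f h.
Proof.
by rewrite /inner mulr_sumr -big_split; apply: eq_bigr => x _ /=; ring.
Qed.

Lemma innerC {R : realType} {X : finType} (pi f g : X -> R) :
  inner pi f g = inner pi g f.
Proof. by apply: eq_bigr => x _; rewrite [f x * _]mulrC. Qed.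

Lemma mean_domain_ge0 {R : realType} (theta : R -> R -> R) (r : R) :
  mean_domain theta r -> 0 <= r.
Proof. by rewrite /mean_domain; case: ifP => //= _ /ltW. Qed.

(** Both sides at rho + e are affine in e, except for the action, which is continuous
    at e = 0 from the right; for e > 0 the density rho + e is positive. *)
Lemma gradient_estimate {R : realType} {X : finType} (Q : X -> X -> R)
    (pi : X -> R) (theta : R -> R -> R) (K : R) (n : \bar R)
    (rho f : X -> R) (t : R) :
  markov_chain Q pi -> mean theta ->
  (forall r s : R, 0 <= r -> 0 <= s -> theta r s <= theta_a r s) ->
  (0 < n)%E -> CD Q pi theta K n ->
  (forall x, 0 <= rho x) -> 0 <= t ->
  inner pi (fun x => heat Q t f x ^+ 2) rho
    + gradient_coeff K t * action_functional Q pi theta rho (heat Q t f)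
    + dimension_coeff K n t * inner pi (fun x => laplacian Q (heat Q t f) x ^+ 2) rho
  <= inner pi (fun x => f x ^+ 2) (heat Q t rho).
Proof.
move=> chain mean_theta theta_le n0 cd rho0 t0.
pose rho_ e x : R := rho x + e * 1.
pose one : X -> R := fun _ => 1.
have rhs : inner pi (fun x => f x ^+ 2) (heat Q t (rho_ e)) @[e --> 0^'+]
    --> inner pi (fun x => f x ^+ 2) (heat Q t rho).
  have -> : (fun e => inner pi (fun x => f x ^+ 2) (heat Q t (rho_ e))) =
      (fun e => inner pi (fun x => f x ^+ 2) (heat Q t rho)
              + e * inner pi (fun x => f x ^+ 2) (heat Q t one)).
    apply/funext => e; rewrite -innerD_scale; congr inner.
    by apply/funext => x; rewrite -(heatD_scale chain).
  exact: cvg_affine0.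
have lhs (g : X -> R) : inner pi g (rho_ e) @[e --> 0^'+] --> inner pi g rho.
  have -> : (fun e => inner pi g (rho_ e)) =
      (fun e => inner pi g rho + e * inner pi g one).
    by apply/funext => e; rewrite -innerD_scale.
  exact: cvg_affine0.
pose lower r := inner pi (fun x => heat Q t f x ^+ 2) r
  + gradient_coeff K t * action_functional Q pi theta r (heat Q t f)
  + dimension_coeff K n t * inner pi (fun x => laplacian Q (heat Q t f) x ^+ 2) r.
have lim : lower (rho_ e) @[e --> 0^'+] --> lower rho.
  apply: cvgD; last by apply: cvgMl_tmp; exact: lhs.
  apply: cvgD; first exact: lhs.
  by apply: cvgMl_tmp; exact: cvg_action_shift.
apply: (ler_cvg_to lim rhs); near=> e.
apply: (gradient_estimate_pos chain mean_theta theta_le n0 cd) => // x.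
by rewrite /rho_ mulr1 ltr_wpDl.
Unshelve. all: by end_near. Qed.

Theorem theorem5p2 (R : realType) (X : finType) (Q : X -> X -> R)
    (pi : X -> R) (theta : R -> R -> R)
    (chain : markov_chain Q pi)
    (mean_theta : mean theta)
    (boundary_theta : has_boundary_partial1 theta)
    (theta_le : forall r s : R, 0 <= r -> 0 <= s ->
       theta r s <= theta_a r s) :
  (forall (K : R) (n : \bar R), (0 < n)%E -> CD Q pi theta K n ->
     forall (rho f : X -> R) (t : R),
       (forall x, mean_domain theta (rho x)) -> 0 <= t ->
       inner pi (fun x => f x ^+ 2) (heat Q t rho)
         - inner pi (fun x => heat Q t f x ^+ 2) rho
       >= gradient_coeff K t * action_functional Q pi theta rho (heat Q t f)
          + dimension_coeff K n t
            * inner pi rho (fun x => laplacian Q (heat Q t f) x ^+ 2)) /\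
  (CD Q pi theta 0 +oo%E ->
     forall (rho f : X -> R) (t : R),
       (forall x, mean_domain theta (rho x)) -> 0 <= t ->
       inner pi (fun x => f x ^+ 2) (heat Q t rho)
       >= 2 * t * action_functional Q pi theta rho (heat Q t f)).
Proof.
split=> [K n n0 cd|cd] rho f t dom t0.
  have rho0 x : 0 <= rho x by exact: mean_domain_ge0 (dom x).
  have := gradient_estimate f chain mean_theta theta_le n0 cd rho0 t0.
  by rewrite [inner pi rho _]innerC => H; lra.
have rho0 x : 0 <= rho x by exact: mean_domain_ge0 (dom x).
have := gradient_estimate f chain mean_theta theta_le (ltry 0) cd rho0 t0.
have -> : dimension_coeff 0 +oo t = 0 :> R.
  by rewrite /dimension_coeff eqxx /inv_dim invey mulr0.
have -> : gradient_coeff 0 t = 2 * t by rewrite /gradient_coeff eqxx.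
rewrite mul0r addr0; apply: le_trans; rewrite lerDr.
apply: sumr_ge0 => x _; apply: mulr_ge0; last first.
  by have /andP[/ltW] := markov_measure_gt0_le1 chain x.
by apply: mulr_ge0 => //; exact: sqr_ge0.
Qed.
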